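(* Let $m\in\mathbb Z\setminus\{0\}$, $h\ge1$ an integer, and $\xi,\xi'\in\mathbb Z_m$ with $d:=\gcd(m,\xi)=\gcd(m,\xi')$; put $\hat m=m/d$. Then: (1) if $\overline{BS}(m,\xi)$ and $\overline{BS}(m,\xi')$ have the same relations up to length $2(|m|+1)h+2|m|+6$, then $\xi\equiv\xi'\pmod{\hat m^hd\,\mathbb Z_m}$; (2) if $\xi\equiv\xi'\pmod{\hat m^hd\,\mathbb Z_m}$, then $\overline{BS}(m,\xi)$ and $\overline{BS}(m,\xi')$ have the same relations up to length $2h$.
   Context: $\mathbb Z_m$ is the ring of $m$-adic integers; $\gcd(m,\xi)$ is the positive integer $d$ with $m\mathbb Z_m+\xi\mathbb Z_m=d\mathbb Z_m$. For $p,q\in\mathbb Z\setminus\{0\}$, $BS(p,q)=\langle a,b\mid ab^pa^{-1}=b^q\rangle$, marked by $(a,b)$. $\mathcal G_2$ is the space of normal subgroups of $\mathbb F(a,b)$ with the ultrametric $d(N_1,N_2)=e^{-\lambda}$, $\lambda$ the minimal word length of an element of $N_1\triangle N_2$. $\overline{BS}(m,\xi)$ is the limit in $\mathcal G_2$ of $BS(m,\xi_n)$ for any sequence of integers $(\xi_n)$ with $|\xi_n|\to\infty$, $\xi_n\to\xi$ in $\mathbb Z_m$ (exists, independent of the sequence). Two marked groups on $(a,b)$ have the same relations up to length $L$ if every reduced word $w\in\mathbb F(a,b)$ with $|w|\le L$ is trivial in one group iff it is trivial in the other. *)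

(* Defs.v *)
From HB Require Import structures.
From mathcomp Require Import all_boot all_order all_algebra.
Set Implicit Arguments. Unset Strict Implicit. Unset Printing Implicit Defensive.
Import Order.TTheory GRing.Theory Num.Theory.
Local Open Scope ring_scope.

(* A letter is (g, e): g = false means a, g = true means b;
   e = false means the generator, e = true its inverse. *)
Definition letter := (bool * bool)%type.
Definition word := seq letter.
Definition la : letter := (false, false).
Definition lb : letter := (true, false).
Definition linv (x : letter) : letter := (x.1, ~~ x.2).
Definition winv (w : word) : word := rev (map linv w).

Definition reduced (w : word) : bool := sorted (fun x y => y != linv x) w.

Inductive free_eq : word -> word -> Prop :=
| fe_refl w : free_eq w w
| fe_sym w w' : free_eq w w' -> free_eq w' w
| fe_trans w1 w2 w3 : free_eq w1 w2 -> free_eq w2 w3 -> free_eq w1 w3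
| fe_cancel (u v : word) (x : letter) : free_eq (u ++ x :: linv x :: v) (u ++ v).

Inductive in_ncl (r : word) : word -> Prop :=
| ncl_nil : in_ncl r [::]
| ncl_conj (u w : word) : in_ncl r w -> in_ncl r (u ++ r ++ winv u ++ w)
| ncl_conjinv (u w : word) : in_ncl r w -> in_ncl r (u ++ winv r ++ winv u ++ w)
| ncl_eq (w w' : word) : free_eq w w' -> in_ncl r w -> in_ncl r w'.

Definition bpow (n : int) : word :=
  match n with
  | Posz k => nseq k lb
  | Negz k => nseq k.+1 (linv lb)
  end.

Definition bs_rel (p q : int) : word := la :: bpow p ++ linv la :: bpow (- q).

Definition BS (p q : int) (w : word) : Prop := in_ncl (bs_rel p q) w.

(* An element of Z_m = lim Z / m^k Z is a compatible sequence of
   residues: zval k represents the element modulo m^k. *)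
Record zadic (m : int) := Zadic {
  zval : nat -> int ;
  zcompat : forall k : nat, (m ^+ k %| zval k.+1 - zval k)%Z }.

Definition zeq m (x y : zadic m) : Prop :=
  forall k, (m ^+ k %| zval x k - zval y k)%Z.

Definition zcong m (x y : zadic m) (c : int) : Prop :=
  exists z : zadic m, forall k, (m ^+ k %| zval x k - zval y k - c * zval z k)%Z.

(* gcd(m, xi) = d : d is the positive divisor of m with
   m Z_m + xi Z_m = d Z_m *)
Definition zgcd m (xi : zadic m) (d : int) : Prop :=
  [/\ 0 < d, (d %| m)%Z,
      (exists u : zadic m, forall k, (m ^+ k %| m - d * zval u k)%Z),
      (exists u : zadic m, forall k, (m ^+ k %| zval xi k - d * zval u k)%Z) &
      (exists u v : zadic m, forall k,
          (m ^+ k %| d - (m * zval u k + zval xi k * zval v k))%Z)].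

Definition admissible m (xi : zadic m) (s : nat -> int) : Prop :=
  (forall B : nat, exists N, forall n, (N <= n)%N -> (B <= `|s n|)%N) /\
  (forall k, exists N, forall n, (N <= n)%N -> (m ^+ k %| s n - zval xi k)%Z).

(* BSbar(m, xi): the limit in G_2 of BS(m, s n) for admissible s.
   w is trivial in the limit iff it is eventually trivial in BS(m, s n). *)
Definition BSbar m (xi : zadic m) (w : word) : Prop :=
  forall s, admissible xi s ->
    exists N, forall n, (N <= n)%N -> BS m (s n) w.

(* two marked groups (given by their sets of trivial words) have the
   same relations up to length L *)
Definition same_rel_upto (G1 G2 : word -> Prop) (L : nat) : Prop :=
  forall w : word, reduced w -> (size w <= L)%N -> (G1 w <-> G2 w).

(* Main.v *)
(* BS(p, q) is an HNN extension of <b>, so a word can be run through a stack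
   machine whose states are the normal forms of its elements.

   (2) Take n and n' large, congruent mod mhat^h d, and run one word in BS(m, n)
   and in BS(m, n').  The exponents of b that occur are nested expressions
   u0 + n (u1 + n (u2 + ...) / m) / m in n and in n' respectively, with the same
   small ui.  Divisibility by n only asks whether u0 = 0, and divisibility by m is
   the same on both sides as long as the nesting depth is at most h, since each
   level costs one factor mhat.  Each level also costs a letter a^-1, and a trivial
   word of length at most 2h contains at most h of them.

   (1) Put x = a^(h+1) b^m a^-1 b^-r1 a^-1 ... b^-rh a^-1, where the ri are the
   successive residues mod m that let n descend through h steps K -> n (K - r) / m.
   In BS(m, n), x is then a power of b, so [x, b] = 1.  Conversely, if [x, b] = 1 in
   BS(m, n'), then n' has the same residues ri, and comparing the two descents
   step by step (Gauss's lemma) gives n = n' mod mhat^h d. *)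
Require Import Defs.
From HB Require Import structures.
From mathcomp Require Import all_boot all_order all_algebra.
From mathcomp Require Import zify ring.
From Stdlib Require Import Setoid Morphisms.
Import Order.TTheory GRing.Theory Num.Theory.
Local Open Scope ring_scope.

(** * Words and equality in BS(p, q) *)

Lemma linvK : involutive linv.
Proof. by case=> g e; rewrite /linv /= negbK. Qed.

Lemma winv_cat u v : winv (u ++ v) = winv v ++ winv u.
Proof. by rewrite /winv map_cat rev_cat. Qed.

Lemma winvK : involutive winv.
Proof. by move=> w; rewrite /winv map_rev revK mapK //; apply: linvK. Qed.

Lemma free_eq_cat u v w w' : free_eq w w' -> free_eq (u ++ w ++ v) (u ++ w' ++ v).
Proof.
elim=> [x|x y _ /fe_sym//|x y z _ Hxy _ Hyz|x y l]; first exact: fe_refl.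
  exact: fe_trans Hxy Hyz.
by rewrite -!catA /= (catA u x) (catA u x (y ++ v)); apply: fe_cancel.
Qed.

Lemma free_eqV w : free_eq (w ++ winv w) [::].
Proof.
elim: w => [|x w IH]; first exact: fe_refl.
rewrite -[x :: w]cat1s winv_cat.
have := free_eq_cat [:: x] (winv [:: x]) _ _ IH; rewrite -!catA => H.
exact: fe_trans H (fe_cancel [::] [::] x).
Qed.

Lemma free_eqVK u w v : free_eq (u ++ w ++ winv w ++ v) (u ++ v).
Proof. by have := free_eq_cat u v _ _ (free_eqV w); rewrite -catA. Qed.

Lemma free_eqVKr u w v : free_eq (u ++ winv w ++ w ++ v) (u ++ v).
Proof. by have := free_eqVK u (winv w) v; rewrite winvK. Qed.

(** The constructors only prepend conjugates of [r] and its inverse; closure under products,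
    conjugation and inverses makes [in_ncl r] a normal subgroup. *)
Lemma in_ncl_cat r v w : in_ncl r v -> in_ncl r w -> in_ncl r (v ++ w).
Proof.
move=> Hv Hw; elim: Hv => [//|u x _ IH|u x _ IH|x y xy _ IH].
- by rewrite -!catA; apply: ncl_conj.
- by rewrite -!catA; apply: ncl_conjinv.
- exact: ncl_eq (free_eq_cat [::] w _ _ xy) IH.
Qed.

Lemma in_ncl_conj r u w : in_ncl r w -> in_ncl r (u ++ w ++ winv u).
Proof.
elim=> [|v x _ IH|v x _ IH|x y xy _ IH].
- exact: ncl_eq (fe_sym (free_eqV u)) (ncl_nil r).
- have := ncl_conj (u ++ v) IH; rewrite winv_cat -!catA; apply: ncl_eq.
  by have := free_eqVKr (u ++ v ++ r ++ winv v) u (x ++ winv u); rewrite -!catA.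
- have := ncl_conjinv (u ++ v) IH; rewrite winv_cat -!catA; apply: ncl_eq.
  by have := free_eqVKr (u ++ v ++ winv r ++ winv v) u (x ++ winv u); rewrite -!catA.
- exact: ncl_eq (free_eq_cat u _ _ _ xy) IH.
Qed.

Lemma free_eq_winv v w : free_eq v w -> free_eq (winv v) (winv w).
Proof.
elim=> [x|x y _ /fe_sym//|x y z _ Hxy _ Hyz|x y l]; first exact: fe_refl.
  exact: fe_trans Hxy Hyz.
rewrite !winv_cat -[l :: _]cat1s -[linv l :: y]cat1s !winv_cat -!catA.
by have := fe_cancel (winv y) (winv x) l; rewrite /winv /= linvK.
Qed.

Lemma in_ncl_winv r w : in_ncl r w -> in_ncl r (winv w).
Proof.
elim=> [|u x Hx IH|u x Hx IH|x y xy _ IH]; first exact: ncl_nil.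
- rewrite !winv_cat winvK -!catA; apply: in_ncl_cat => //.
  by have := ncl_conjinv u (ncl_nil r); rewrite cats0.
- rewrite !winv_cat !winvK -!catA; apply: in_ncl_cat => //.
  by have := ncl_conj u (ncl_nil r); rewrite cats0.
- exact: ncl_eq (free_eq_winv _ _ xy) IH.
Qed.

(** Kept as a relation on words, with [cat] and [winv] as morphisms, so that group computations
    become setoid rewriting. *)
Definition eqBS (p q : int) (v w : word) : Prop := BS p q (v ++ winv w).

Global Instance eqBS_equivalence p q : Equivalence (eqBS p q).
Proof.
split=> [w|v w H|u v w Huv Hvw].
- exact: ncl_eq (fe_sym (free_eqV w)) (ncl_nil _).
- by have := in_ncl_winv _ _ H; rewrite winv_cat winvK.
- have := in_ncl_cat _ _ _ Huv Hvw; rewrite -catA; apply: ncl_eq.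
  exact: free_eqVKr.
Qed.

Global Instance eqBS_cat p q :
  Proper (eqBS p q ==> eqBS p q ==> eqBS p q) (@cat letter).
Proof.
move=> v v' Hv w w' Hw; transitivity (v ++ w').
  by have := in_ncl_conj _ v _ Hw; rewrite /eqBS winv_cat -!catA.
rewrite /eqBS winv_cat -catA; apply: ncl_eq Hv; apply: fe_sym.
exact: free_eqVK.
Qed.

Lemma eqBS_nil p q w : eqBS p q w [::] <-> BS p q w.
Proof. by rewrite /eqBS cats0. Qed.

Lemma eqBS_rV p q w : eqBS p q (w ++ winv w) [::].
Proof. by apply/eqBS_nil; apply: ncl_eq (fe_sym (free_eqV w)) (ncl_nil _). Qed.

Lemma eqBS_lV p q w : eqBS p q (winv w ++ w) [::].
Proof. by have := eqBS_rV p q (winv w); rewrite winvK. Qed.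

Global Instance eqBS_winv p q : Proper (eqBS p q ==> eqBS p q) winv.
Proof.
move=> v w Hvw; transitivity (winv v ++ (w ++ winv w)).
  by rewrite eqBS_rV cats0; reflexivity.
transitivity ((winv v ++ v) ++ winv w); last by rewrite eqBS_lV; reflexivity.
rewrite catA; apply: eqBS_cat; last reflexivity.
by apply: eqBS_cat; [reflexivity|symmetry].
Qed.

Lemma bpowN n : bpow (- n) = winv (bpow n).
Proof.
have H k e : winv (nseq k (true, e)) = nseq k (true, ~~ e).
  by rewrite /winv map_nseq rev_nseq.
case: n => [[|k]|k] //.
- by rewrite -NegzE; exact: esym (H k.+1 false).
- by rewrite NegzE opprK; exact: esym (H k.+1 true).
Qed.

Lemma bpowS p q n : eqBS p q (bpow (n + 1)) (bpow n ++ [:: lb]).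
Proof.
case: n => [k|[|k]].
- by rewrite -PoszD /bpow nseqD; reflexivity.
- by rewrite /=; symmetry; apply: (eqBS_lV p q [:: lb]).
have -> : Negz k.+1 + 1 = Negz k by lia.
have -> : bpow (Negz k.+1) = bpow (Negz k) ++ [:: linv lb].
  by rewrite /bpow -(addn1 k.+1) nseqD.
rewrite -catA; have H : eqBS p q ([:: linv lb] ++ [:: lb]) [::].
  exact: (eqBS_lV p q [:: lb]).
by rewrite H cats0; reflexivity.
Qed.

Lemma bpowD p q i j : eqBS p q (bpow (i + j)) (bpow i ++ bpow j).
Proof.
have bpowP n : eqBS p q (bpow (n - 1)) (bpow n ++ [:: linv lb]).
  have := bpowS p q (n - 1); rewrite subrK => ->.
  by rewrite -catA (eqBS_rV p q [:: lb]) cats0; reflexivity.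
elim: j => [|j IH|j IH]; first by rewrite addr0 cats0; reflexivity.
- have -> : j.+1%:Z = j%:Z + 1 by lia.
  by rewrite addrA !bpowS IH catA; reflexivity.
- have -> : - j.+1%:Z = - j%:Z - 1 by lia.
  by rewrite addrA !bpowP IH catA; reflexivity.
Qed.

(** The associated subgroups of the HNN extension: [b^q] passes [a] and becomes [b^p], while [b^p]
    passes [a^-1] and becomes [b^q]. Indexing by the sign treats both letters at once. *)
Definition expo (p q : int) (e : bool) := if e then p else q.

Lemma eqBS_rel p q e : eqBS p q (bpow (expo p q e) ++ [:: (false, e)])
                                ([:: (false, e)] ++ bpow (expo p q (~~ e))).
Proof.
have H : eqBS p q ([:: la] ++ bpow p) (bpow q ++ [:: la]).
  have := ncl_conj [::] (ncl_nil (bs_rel p q)).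
  by rewrite /= cats0 /eqBS /BS winv_cat -bpowN.
case: e => /=; last by symmetry.
transitivity ([:: linv la] ++ ([:: la] ++ bpow p) ++ [:: linv la]).
  have E := eqBS_lV p q [:: la].
  by rewrite !catA E cat0s; reflexivity.
rewrite H -catA (eqBS_rV p q [:: la]) cats0; reflexivity.
Qed.

Lemma eqBS_relM p q e j :
  eqBS p q (bpow (expo p q e * j) ++ [:: (false, e)])
           ([:: (false, e)] ++ bpow (expo p q (~~ e) * j)).
Proof.
have R := eqBS_rel p q e; set x := [:: (false, e)] in R *.
have RN : eqBS p q (bpow (- expo p q e) ++ x) (x ++ bpow (- expo p q (~~ e))).
  rewrite !bpowN; set u := bpow _ in R *; set v := bpow _ in R *.
  transitivity (winv u ++ (x ++ v) ++ winv v).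
    by rewrite -catA (eqBS_rV p q v) cats0; reflexivity.
  by rewrite -R !catA (eqBS_lV p q u) cat0s; reflexivity.
elim: j => [|j IH|j IH]; first by rewrite !mulr0 cats0; reflexivity.
- have -> : j.+1%:Z = j%:Z + 1 by lia.
  by rewrite !mulrDr !mulr1 !bpowD -catA R catA IH -catA; reflexivity.
- have -> : - j.+1%:Z = - j%:Z - 1 by lia.
  by rewrite !mulrDr !mulrN1 !bpowD -catA RN catA IH -catA; reflexivity.
Qed.

(** * The normal-form machine *)

(* Centered residues: a small u is the residue of u + q j for every j, whatever the
   sign of u, which is what makes the stacks for two large q comparable. *)
Definition cmod (k q : int) : int :=
  if 2 * (k %% q)%Z <= `|q| then (k %% q)%Z else (k %% q)%Z - `|q|.

Lemma cmod_dvd k q : (q %| k - cmod k q)%Z.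
Proof.
have H : (q %| k - (k %% q)%Z)%Z by rewrite -eqz_mod_dvd modz_mod.
rewrite /cmod; case: ifP => // _.
by rewrite opprB addrCA rpredD // abszEsign dvdz_mull.
Qed.

Lemma eq_cmod k k' q : (q %| k - k')%Z -> cmod k q = cmod k' q.
Proof. by rewrite -eqz_mod_dvd /cmod => /eqP ->. Qed.

Lemma cmod_id k q : cmod (cmod k q) q = cmod k q.
Proof. by apply: eq_cmod; rewrite -opprB rpredN cmod_dvd. Qed.

Lemma cmod_small k q : 2 * `|k| < `|q| -> cmod k q = k.
Proof.
move=> kq; have q0 : q != 0 by apply/eqP => q0; move: kq; rewrite q0; lia.
rewrite /cmod; have [k0|k0] := lerP 0 k.
  have -> : (k %% q)%Z = k by rewrite -modz_abs modz_small //; lia.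
  by case: ifP; lia.
have -> : (k %% q)%Z = k + `|q| by rewrite -(modz_abs k q) -modzDr modz_small; lia.
by case: ifP; lia.
Qed.

Lemma cmod_le k q : q != 0 -> `|cmod k q| <= `|q|.
Proof.
move=> q0; have := modz_ge0 k q0; have := ltz_mod k q0.
by rewrite /cmod; case: ifP; lia.
Qed.

Lemma dvd_cmod k q : (q %| k)%Z = (cmod k q == 0).
Proof.
apply/idP/eqP => [qk|k0]; last by have := cmod_dvd k q; rewrite k0 subr0.
have -> : cmod k q = cmod 0 q by apply: eq_cmod; rewrite subr0.
by rewrite /cmod mod0z mulr0 normr_ge0.
Qed.

(* ([:: (t_r, e_r); ...; (t_1, e_1)], k) stands for
   b^t_1 a^e_1 ... b^t_r a^e_r b^k, where e = true encodes a^-1. *)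
Definition state := (seq (int * bool) * int)%type.

(** The pinch of Britton's lemma: [a^-e b^k a^e] with [b^k] in the associated subgroup. *)
Definition pinch p q (e : bool) (s : state) :=
  (if s.1 is (_, e') :: _ then e' != e else false) && (expo p q e %| s.2)%Z.

(** Without a pinch, a coset representative stays left of the letter and the rest passes it. The
    default of [head] is never reached, since a pinch needs a nonempty stack. *)
Definition astep p q (e : bool) (s : state) : state :=
  let: D := expo p q e in let: M := expo p q (~~ e) in
  if pinch p q e s
  then (behead s.1, (head (0, e) s.1).1 + M * (s.2 %/ D)%Z)
  else ((cmod s.2 D, e) :: s.1, M * ((s.2 - cmod s.2 D) %/ D)%Z).

Definition shift (n : int) (s : state) : state := (s.1, s.2 + n).

Definition step p q (s : state) (x : letter) : state :=
  if x.1 then shift (if x.2 then -1 else 1) s else astep p q x.2 s.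

Definition run p q (w : word) (s : state) : state := foldl (step p q) s w.

Lemma run_cat p q u v s : run p q (u ++ v) s = run p q v (run p q u s).
Proof. exact: foldl_cat. Qed.

Lemma run_bpow p q n s : run p q (bpow n) s = shift n s.
Proof.
have H k e t : run p q (nseq k (true, e)) t = shift (k%:Z * (if e then -1 else 1)) t.
  elim: k t => [|k IH] [st i]; first by rewrite /shift mul0r addr0.
  rewrite [LHS]IH /shift /step /=; congr pair; rewrite (_ : k.+1%:Z = 1 + k%:Z) ?mulrDl; lia.
case: n => k; first by rewrite [LHS](H k false) mulr1.
by rewrite [LHS](H k.+1 true); congr shift; lia.
Qed.

(** Normal forms of the HNN extension; the condition [t != 0] excludes the subwords [a a^-1] and
    [a^-1 a]. *)
Fixpoint valid p q (st : seq (int * bool)) : bool :=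
  if st is (t, e) :: st' then
    [&& cmod t (expo p q e) == t,
        (if st' is (_, e') :: _ then (e' != e) ==> (t != 0) else true)
      & valid p q st']
  else true.

Section Machine.
Variables p q : int.
Hypotheses (p0 : p != 0) (q0 : q != 0).

Lemma expo_neq0 e : expo p q e != 0.
Proof. by case: e. Qed.

Lemma astep_pop e t st j :
  astep p q e ((t, ~~ e) :: st, expo p q e * j) = (st, t + expo p q (~~ e) * j).
Proof.
by rewrite /astep /pinch /= dvdz_mulr // mulKz ?expo_neq0 //; case: e.
Qed.

Lemma astep_push e t st j :
  cmod t (expo p q e) = t ->
  ~~ pinch p q e (st, t + expo p q e * j) ->
  astep p q e (st, t + expo p q e * j) = ((t, e) :: st, expo p q (~~ e) * j).
Proof.
move=> ct /negbTE np; rewrite /astep np /=.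
have -> : cmod (t + expo p q e * j) (expo p q e) = t.
  by rewrite -{2}ct; apply: eq_cmod; rewrite addrAC subrr add0r dvdz_mulr.
by rewrite addrAC subrr add0r mulKz ?expo_neq0.
Qed.

Variant astep_spec e : state -> state -> Prop :=
| AstepPop t st j :
    astep_spec e ((t, ~~ e) :: st, expo p q e * j) (st, t + expo p q (~~ e) * j)
| AstepPush t st j :
    cmod t (expo p q e) = t -> ~~ pinch p q e (st, t + expo p q e * j) ->
    astep_spec e (st, t + expo p q e * j) ((t, e) :: st, expo p q (~~ e) * j).

Lemma astepP e s : astep_spec e s (astep p q e s).
Proof.
case: s => st k; have [|np] := boolP (pinch p q e (st, k)).
  rewrite /pinch; case: st => [//|[t e'] st] /= /andP[ee' /dvdzP[j ->]].
  have -> : e' = ~~ e by case: e e' ee' => [] [].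
  by rewrite mulrC astep_pop; apply: AstepPop.
have /dvdzP[j Hj] := cmod_dvd k (expo p q e).
have ct := cmod_id k (expo p q e); set t := cmod k _ in Hj ct.
have Ek : k = t + expo p q e * j by rewrite mulrC -Hj addrC subrK.
by move: np; rewrite Ek => np; rewrite astep_push //; apply: AstepPush.
Qed.

Lemma astep_valid e s : valid p q s.1 -> valid p q (astep p q e s).1.
Proof.
case: astepP => [t st j|t st j ct np] /=; first by case/and3P.
move=> vst; apply/and3P; split=> //; first exact/eqP.
case: st np {vst} => [//|[t' e'] st]; rewrite /pinch /= => np.
apply/implyP => ee'; move: np; rewrite ee' /=; apply: contra => /eqP ->.
by rewrite add0r dvdz_mulr.
Qed.

(** Undoing a push is a pop. Undoing a pop must be a push: if the letter below could pinch, validity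
    gives [t != 0], and a nonzero centered residue is not divisible by its modulus. *)
Lemma astepK e s : valid p q s.1 -> astep p q (~~ e) (astep p q e s) = s.
Proof.
case: (astepP e s) => [t st j|t st j ct np] /=.
  case/and3P => /eqP ct tst vst.
  rewrite astep_push ?negbK // /pinch /=.
  case: st tst vst => [//|[t' e'] st] tst _ /=; rewrite negb_and.
  case: eqVneq tst => //= _ t0; rewrite rpredDr ?dvdz_mulr // dvd_cmod ct.
  exact: t0.
by have := astep_pop (~~ e) t st j; rewrite negbK.
Qed.

(** The defining relation as the machine sees it; with [astepK] it makes the relator act
    trivially. *)
Lemma astep_shift e i s :
  astep p q e (shift (expo p q e * i) s) = shift (expo p q (~~ e) * i) (astep p q e s).
Proof.
case: (astepP e s) => [t st j|t st j ct np]; rewrite /shift /=.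
  by rewrite -mulrDr astep_pop mulrDr addrA.
rewrite -addrA -mulrDr astep_push ?mulrDr // -mulrDr.
move: np; rewrite /pinch /=; case: st => [//|[t' e'] st].
by rewrite !rpredDr ?dvdz_mulr.
Qed.

Lemma step_valid s x : valid p q s.1 -> valid p q (step p q s x).1.
Proof. by rewrite /step; case: x.1 => //; apply: astep_valid. Qed.

Lemma run_valid w s : valid p q s.1 -> valid p q (run p q w s).1.
Proof. by elim: w s => [//|x w IH] s vs; apply/IH/step_valid. Qed.

Lemma stepK x s : valid p q s.1 -> step p q (step p q s x) (linv x) = s.
Proof.
case: x => [[] e] vs; rewrite /step /=; last exact: astepK.
by case: s vs => st k _; rewrite /shift /=; case: e; rewrite /= addrK ?subrK.
Qed.

Lemma run_winv w s : valid p q s.1 -> run p q (winv w) (run p q w s) = s.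
Proof.
elim/last_ind: w => [//|w x IH] vs.
rewrite -cats1 winv_cat !run_cat /= stepK ?IH //; exact: run_valid.
Qed.

Lemma run_free_eq v w s : free_eq v w -> valid p q s.1 -> run p q v s = run p q w s.
Proof.
move=> H vs; elim: H => [//|//|x y z _ -> _ -> //|x y l].
by rewrite !run_cat /= stepK //; apply: run_valid.
Qed.

Lemma run_bs_rel s : valid p q s.1 -> run p q (bs_rel p q) s = s.
Proof.
move=> vs; rewrite -[bs_rel p q]/([:: la] ++ bpow p ++ [:: linv la] ++ bpow (- q)).
rewrite !run_cat !run_bpow /= /step /=.
have := astep_shift true 1 (astep p q false s); rewrite !mulr1 /= => ->.
by rewrite (astepK false) //; case: (s) => st k; rewrite /shift /= addrK.
Qed.

(** Steps are invertible on valid states, so words act on these by permutations; the relator acts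
    trivially, hence so does its normal closure. *)
Lemma run_BS w s : BS p q w -> valid p q s.1 -> run p q w s = s.
Proof.
move=> H; elim: H s => [//|u v _ IH|u v _ IH|x y xy _ IH] s vs.
- have vu := run_valid u s vs.
  by rewrite !run_cat run_bs_rel // run_winv // IH.
- have vu := run_valid u s vs; rewrite !run_cat.
  have -> : run p q (winv (bs_rel p q)) (run p q u s) = run p q u s.
    by rewrite -{1}(run_bs_rel _ vu) run_winv.
  by rewrite run_winv // IH.
- by rewrite -(run_free_eq _ _ _ xy) // IH.
Qed.

Fixpoint stack_word (st : seq (int * bool)) : word :=
  if st is (t, e) :: st' then stack_word st' ++ bpow t ++ [:: (false, e)] else [::].

Definition state_word (s : state) : word := stack_word s.1 ++ bpow s.2.

Lemma state_word_step s x :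
  eqBS p q (state_word (step p q s x)) (state_word s ++ [:: x]).
Proof.
rewrite /step; case: x => [[] e] /=.
  by rewrite /state_word /= bpowD -catA; case: e; reflexivity.
case: astepP => [t st j|t st j ct np]; rewrite /state_word /=.
  rewrite bpowD -!catA eqBS_relM.
  have H w : eqBS p q ([:: (false, ~~ e), (false, e) & w]) w.
    have := eqBS_rV p q [:: (false, ~~ e)]; rewrite /winv /= /linv /= negbK => H.
    exact: (eqBS_cat p q _ _ H w w (reflexivity w)).
  do 2![apply: eqBS_cat; first reflexivity]; symmetry; exact: H.
by rewrite bpowD -!catA eqBS_relM; reflexivity.
Qed.

Lemma state_word_run w s :
  eqBS p q (state_word (run p q w s)) (state_word s ++ w).
Proof.
elim: w s => [|x w IH] s /=; first by rewrite cats0; reflexivity.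
by rewrite IH state_word_step -catA; reflexivity.
Qed.

(** The normal form theorem. One direction is the action on valid states; the other holds because a
    state denotes, in the group, the word that led to it. *)
Lemma BS_run w : BS p q w <-> run p q w ([::], 0) = ([::], 0).
Proof.
split=> [H|H]; first exact: run_BS.
by have := state_word_run w ([::], 0); rewrite H /= => E; apply/eqBS_nil; symmetry.
Qed.

Lemma eqBS_run v w s : eqBS p q v w -> valid p q s.1 -> run p q v s = run p q w s.
Proof.
move=> H vs; have := run_BS _ s H vs; rewrite run_cat => Hs.
have := run_winv (winv w) (run p q v s) (run_valid v s vs).
by rewrite winvK Hs.
Qed.

End Machine.

(** * Running a word in BS(m, n) and BS(m, n') simultaneously *)

Lemma dvdz_small (n u : int) : (n %| u)%Z -> `|u| < `|n| -> u = 0.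
Proof.
move=> nu un; apply/eqP; rewrite -absz_eq0; move: nu; rewrite dvdzE.
by case: (posnP `|u|%N) => [-> //|u0 /(dvdn_leq u0)]; lia.
Qed.

Definition asum (w : word) : int :=
  (count_mem la w)%:Z - (count_mem (linv la) w)%:Z.

Lemma asum_cat v w : asum (v ++ w) = asum v + asum w.
Proof. by rewrite /asum !count_cat; lia. Qed.

Lemma asum_winv w : asum (winv w) = - asum w.
Proof.
rewrite /asum /winv !count_rev !count_map opprB; congr (_%:Z - _%:Z).
- by apply: eq_count => -[[] []].
- by apply: eq_count => -[[] []].
Qed.

Lemma asum_bpow n : asum (bpow n) = 0.
Proof. by case: n => k; rewrite /asum /bpow !count_nseq. Qed.

Lemma asum_free_eq v w : free_eq v w -> asum v = asum w.
Proof.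
elim=> // [x y z _ -> _ -> //|x y [[] []]];
by rewrite !asum_cat; congr (_ + _); rewrite /asum /=; lia.
Qed.

(** A trivial word thus has as many letters [a] as [a^-1], which later bounds the nesting depth by
    half the length. *)
Lemma BS_asum p q w : BS p q w -> asum w = 0.
Proof.
have r0 : asum (bs_rel p q) = 0.
  rewrite -[bs_rel p q]/([:: la] ++ bpow p ++ [:: linv la] ++ bpow (- q)).
  by rewrite !asum_cat !asum_bpow.
elim=> [//|u x _ IH|u x _ IH|x y /asum_free_eq <- //];
by rewrite !asum_cat !asum_winv r0 IH; lia.
Qed.

(* The b-exponents reached by the same word in BS(m, n) and BS(m, n'): nested
   expressions u0 + n (u1 + n (u2 + ...) / m) / m with the same small ui. *)
Inductive coupled (m n n' B : int) : nat -> int -> int -> Prop :=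
| CoupledBase l u : `|u| <= B -> coupled m n n' B l u u
| CoupledStep l u j j' : `|u| <= B -> coupled m n n' B l (m * j) (m * j') ->
    coupled m n n' B l.+1 (u + n * j) (u + n' * j').

Lemma coupled_leq (m n n' B B' : int) l l' k k' : B <= B' -> (l <= l')%N ->
  coupled m n n' B l k k' -> coupled m n n' B' l' k k'.
Proof.
move=> BB' ll' H; elim: H l' ll' => [i u uB|i u j j' uB _ IH] l' il'.
  by constructor; apply: le_trans BB'.
case: l' il' => // l' il'; constructor; first exact: le_trans BB'.
exact: IH.
Qed.

(** A base value is also a step with [j = j' = 0], so both constructors can be treated alike. *)
Lemma coupled_inv (m n n' B : int) l k k' : coupled m n n' B l k k' ->
  exists u j j', [/\ k = u + n * j, k' = u + n' * j', `|u| <= B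
                   & coupled m n n' B l (m * j) (m * j')].
Proof.
case=> [i u uB|i u j j' uB H].
  by exists u, 0, 0; rewrite !mulr0 !addr0; split=> //; constructor; lia.
by exists u, j, j'; split=> //; apply: coupled_leq H.
Qed.

Lemma coupled_add (m n n' B : int) l k k' c : coupled m n n' B l k k' ->
  coupled m n n' (B + `|c|) l (k + c) (k' + c).
Proof.
case=> [i u uB|i u j j' uB H]; first by constructor; lia.
rewrite ![u + _ + c]addrAC; constructor; first by lia.
by apply: coupled_leq H => //; lia.
Qed.

(** If the value is 0, then [u] is a multiple of [n] smaller than [n], so [u = 0] and [j = 0]; the
    inner value vanishes too, and induction gives [j' = 0]. *)
Lemma coupled_eq0 (m n n' B : int) l k k' : m != 0 -> B < `|n| ->
  coupled m n n' B l k k' -> k = 0 -> k' = 0.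
Proof.
move=> m0 Bn; elim=> [//|{}l u j j' uB _ IH] E.
have n0 : n != 0 by lia.
have u0 : u = 0.
  apply: (@dvdz_small n); last exact: le_lt_trans Bn.
  have -> : u = n * (- j) by apply/eqP; rewrite mulrN -addr_eq0; apply/eqP.
  exact: dvdz_mulr.
move/eqP: E; rewrite u0 add0r mulf_eq0 (negbTE n0) /= => /eqP j0.
have /eqP := IH (etrans (congr1 _ j0) (mulr0 m)).
by rewrite mulf_eq0 (negbTE m0) /= => /eqP ->; rewrite mulr0.
Qed.

(** The difference is [(n - n') j + n' (j - j')]. By induction [mh^(i+1) d] divides [m (j - j')], so
    [mh^i] divides [j - j'], and [n'] gives back the factor [d]: a level costs exactly one [mh]. *)
Lemma coupled_dvd (m n n' d mh : int) h B l i k k' :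
  m != 0 -> m = mh * d -> (d %| n')%Z -> (mh ^+ h * d %| n - n')%Z ->
  coupled m n n' B l k k' -> (l + i <= h.+1)%N -> (mh ^+ i * d %| k - k')%Z.
Proof.
move=> m0 Em dn' nn' H.
elim: H i => [{}l u _|{}l u j j' uB _ IH] i il; first by rewrite subrr dvdz0.
have -> : u + n * j - (u + n' * j') = (n - n') * j + n' * (j - j') by ring.
apply: rpredD.
  apply/dvdz_mulr/(dvdz_trans _ nn')/dvdz_mul => //.
  by rewrite dvdz_exp2l // -ltnS (leq_trans _ il) // addSn ltnS leq_addl.
rewrite mulrC dvdz_mul //.
have := IH i.+1; rewrite addnS -addSn => /(_ il).
have d0 : d != 0 by apply: contraNneq m0 => d0; rewrite Em d0 mulr0.
have mh0 : mh != 0 by apply: contraNneq m0 => mh0; rewrite Em mh0 mul0r.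
have -> : m * j - m * j' = mh * ((j - j') * d) by rewrite Em; ring.
by rewrite exprS -mulrA dvdz_mul2l // dvdz_mul2r.
Qed.

Section Coupling.
Variables (m n n' : int) (h : nat).
Hypothesis m0 : m != 0.
Hypothesis coupled_mod : forall B l k k',
  coupled m n n' B l k k' -> (l <= h)%N -> (m %| k - k')%Z.

Definition coupled_states (B : int) (l : nat) (s s' : state) :=
  [/\ s.1 = s'.1, all (fun x : int * bool => `|x.1| <= B) s.1
    & coupled m n n' B l s.2 s'.2].

(** Reading [a^-1] tests divisibility by [m], where [coupled_mod] makes both sides agree, and adds a
    nesting level. Reading [a] tests divisibility by [n] and by [n'], which on both sides means
    [u = 0]. The bound [2 * B + 1] covers adding a stack entry as well as adding one letter [b]. *)
Lemma coupled_astep (B : int) l (e : bool) s s' : coupled_states B l s s' ->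
  `|m| <= B -> 2 * B < `|n| -> 2 * B < `|n'| -> (l + e <= h)%N ->
  coupled_states (2 * B + 1) (l + e) (astep m n e s) (astep m n' e s').
Proof.
case: s s' => st k [st' k'] [/= <- stB kk'] mB Bn Bn' le.
have n0 : n != 0 by lia. have n'0 : n' != 0 by lia.
have B0 : 0 <= B := le_trans (normr_ge0 m) mB.
have BB : B <= 2 * B + 1 by lia.
have Badd c : `|c| <= B -> B + `|c| <= 2 * B + 1 by lia.
have weak (r : seq (int * bool)) : all (fun x => `|x.1| <= B) r ->
    all (fun x => `|x.1| <= 2 * B + 1) r.
  by move/allP => sb; apply/allP => x /sb /le_trans; apply.
case: e le => le.
- have mkk : (m %| k - k')%Z.
    by apply: coupled_mod kk' _; apply: leq_trans le; apply: leq_addr.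
  have Epinch : pinch m n' true (st, k') = pinch m n true (st, k).
    rewrite /pinch /=; congr (_ && _).
    by rewrite -[in RHS](subrK k' k) rpredDl.
  case: (boolP (pinch m n true (st, k))) => np.
    move: np; rewrite /pinch; case: st stB {Epinch} => [//|[t [] ] st] //=.
    case/andP=> tB stB mk.
    have mk' : (m %| k')%Z by rewrite -(rpredDl _ mkk) subrK.
    have /dvdzP[j Ek] := mk; have /dvdzP[j' Ek'] := mk'.
    move: kk'; rewrite Ek Ek' ![_ * m]mulrC => kk'.
    rewrite (astep_pop m n m0 n0 true) (astep_pop m n' m0 n'0 true) /=.
    split=> //=; first exact: weak.
    rewrite addn1; constructor; first exact: le_trans BB.
    exact: coupled_leq kk'.
  have /dvdzP[j Ej] := cmod_dvd k m; have /dvdzP[j' Ej'] := cmod_dvd k' m.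
  have ct := cmod_id k m; have tm := cmod_le k m m0.
  have Et := eq_cmod _ _ _ mkk; rewrite -Et in Ej'.
  set t := cmod k m in ct tm Ej Ej' Et.
  have Ek : k = t + m * j by rewrite [m * j]mulrC -Ej addrC subrK.
  have Ek' : k' = t + m * j' by rewrite [m * j']mulrC -Ej' addrC subrK.
  have np' : ~~ pinch m n' true (st, k') by rewrite Epinch.
  move: np np'; rewrite {1}Ek {1}Ek' => np np'.
  rewrite {1}Ek {1}Ek' (astep_push m n m0 n0 true) // (astep_push m n' m0 n'0 true) //=.
  split=> //=; first by rewrite weak // andbT; apply: le_trans BB; apply: le_trans mB.
  rewrite addn1 -[n * j]add0r -[n' * j']add0r; constructor.
    by rewrite normr0; apply: le_trans BB.
  have := coupled_add _ _ _ _ _ _ _ (- t) kk'.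
  by rewrite Ek Ek' !(addrC t) !addrK;
    apply: coupled_leq => //; rewrite normrN Badd // (le_trans tm).
- have [u [j [j' [-> -> uB jj']]]] := coupled_inv _ _ _ _ _ _ _ kk'.
  have pinchE q i : q != 0 -> 2 * B < `|q| -> pinch m q false (st, u + q * i) =
      (if st is (_, e') :: _ then e' != false else false) && (u == 0).
    move=> q0 Bq; rewrite /pinch /=; congr (_ && _); rewrite rpredDr ?dvdz_mulr //.
    by apply/idP/eqP => [qu|->]; [apply: dvdz_small qu _; lia|apply: dvdz0].
  case: (boolP (pinch m n false (st, u + n * j))) => np.
    move: np; rewrite pinchE //; case: st stB {pinchE} => [//|[t [] ] st] //=.
    case/andP=> tB stB /eqP ->; rewrite !add0r.
    rewrite (astep_pop m n m0 n0 false) (astep_pop m n' m0 n'0 false) /=.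
    split=> //=; first exact: weak.
    have := coupled_add _ _ _ _ _ _ _ t jj'; rewrite ![_ + t]addrC addn0.
    by apply: coupled_leq => //; apply: Badd.
  have np' : ~~ pinch m n' false (st, u + n' * j').
    by move: np; rewrite !pinchE.
  rewrite (astep_push m n m0 n0 false) ?(astep_push m n' m0 n'0 false) //=;
    try by apply: cmod_small; lia.
  split=> //=; first by rewrite weak // andbT (le_trans uB).
  by rewrite addn0; apply: coupled_leq jj'.
Qed.

(** Bounds the small coefficients after [i] letters independently of [n] and [n'], so the terms of
    an admissible sequence eventually exceed it. *)
Definition growth (i : nat) (B : int) : int := iter i (fun b => 2 * b + 1) B.

Lemma growth_ge i (B : int) : 0 <= B -> B <= growth i B.
Proof. by move=> B0; elim: i => [//|i IH]; rewrite /growth iterS -/(growth i B); lia. Qed.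

Lemma coupled_run w (B : int) l s s' : coupled_states B l s s' ->
  `|m| <= B -> 2 * growth (size w) B < `|n| -> 2 * growth (size w) B < `|n'| ->
  (l + count_mem (linv la) w <= h)%N ->
  coupled_states (growth (size w) B) (l + count_mem (linv la) w)
    (run m n w s) (run m n' w s').
Proof.
elim: w B l s s' => [|x w IH] B l s s' H mB; first by rewrite addn0.
have -> : growth (size (x :: w)) B = growth (size w) (2 * B + 1) by apply: iterSr.
move=> Bn Bn'.
rewrite -[count_mem _ _]/((x == linv la) + count_mem (linv la) w)%N addnA => lh.
have Bg : 2 * B + 1 <= growth (size w) (2 * B + 1) by apply: growth_ge; lia.
apply: IH => //; try lia.
case: x lh => [[] e] lh; last first.
  have Ee : ((false, e) == linv la) = e by case: (e).
  move: lh; rewrite Ee => lh; apply: coupled_astep => //; lia.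
have -> : ((true, e) == linv la) = false by case: (e).
have [H1 H2 H3] := H; rewrite addn0; split; first exact: H1.
  by apply: sub_all H2 => y /=; lia.
by apply: coupled_leq (coupled_add _ _ _ _ _ _ _ _ H3) => //; case: (e) => /=; lia.
Qed.

Lemma BS_transfer w : (size w <= 2 * h)%N ->
  2 * growth (size w) `|m| < `|n| -> 2 * growth (size w) `|m| < `|n'| ->
  BS m n w -> BS m n' w.
Proof.
move=> wh wn wn' Hw.
have mg : `|m| <= growth (size w) `|m| by apply: growth_ge.
have wc : (count_mem (linv la) w <= h)%N.
  have := BS_asum _ _ _ Hw; rewrite /asum => w0.
  have : (count_mem la w + count_mem (linv la) w <= size w)%N; last by lia.
  rewrite -count_predUI (@eq_count _ (predI _ _) pred0) ?count_pred0 ?addn0 ?count_size //.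
  by move=> [[] []].
have /coupled_run := wn'; move=> /(_ 0%N ([::], 0) ([::], 0)).
have H0 : coupled_states `|m| 0 ([::], 0) ([::], 0) by split=> //; constructor.
move=> /(_ H0 (lexx _) wn wc).
have n0 : n != 0 by lia. have n'0 : n' != 0 by lia.
move/(BS_run _ _ m0 n0): Hw => ->.
move=> Hr; apply/(BS_run _ _ m0 n'0).
case: (run m n' w _) Hr => st k [/= <- _ H2].
have gn : growth (size w) `|m| < `|n| by lia.
by rewrite (coupled_eq0 _ _ _ _ _ _ _ m0 gn H2).
Qed.

End Coupling.

(** * Test words and descents *)

Lemma reduced_cat x u y v :
  reduced (x :: u) -> reduced (y :: v) -> y != linv (last x u) ->
  reduced ((x :: u) ++ (y :: v)).
Proof. by rewrite /reduced /= cat_path /= => -> -> ->. Qed.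

Lemma reduced_winv w : reduced w -> reduced (winv w).
Proof.
rewrite /reduced /winv rev_sorted sorted_map; apply: sub_sorted => x y /=.
by rewrite linvK; apply: contraNneq => <-.
Qed.

Fixpoint descent (rs : seq nat) : word :=
  if rs is r :: rs' then nseq r (linv lb) ++ linv la :: descent rs' else [::].

(* a^(h+1) b^m a^-1 b^-r_1 a^-1 ... b^-r_h a^-1 *)
Definition tower (m : int) (rs : seq nat) : word :=
  nseq (size rs).+1 la ++ bpow m ++ linv la :: descent rs.

Definition test_word (m : int) (rs : seq nat) : word :=
  tower m rs ++ lb :: winv (tower m rs) ++ [:: linv lb].

Lemma size_winv w : size (winv w) = size w.
Proof. by rewrite /winv size_rev size_map. Qed.

Lemma size_bpow n : size (bpow n) = `|n|%N.
Proof. by case: n => k; rewrite size_nseq. Qed.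

Lemma size_descent b rs : all (fun r => r < b)%N rs ->
  (size (descent rs) <= b * size rs)%N.
Proof.
elim: rs => [//|r rs IH] /= /andP[rb /IH H].
by rewrite size_cat size_nseq /= mulnS; lia.
Qed.

(** Each residue costs one [a], one [a^-1] and at most [|m| - 1] letters [b^-1]. The remaining
    [a b^m a^-1] has [|m| + 2] letters. All this is doubled, and two letters [b], [b^-1] are
    added. *)
Lemma size_test_word m rs : all (fun r => r < `|m|)%N rs ->
  (size (test_word m rs) <= 2 * (`|m| + 1) * size rs + 2 * `|m| + 6)%N.
Proof.
move=> /size_descent Hd.
have Ht : size (tower m rs) = (size rs + `|m| + size (descent rs) + 2)%N.
  by rewrite /tower !size_cat size_nseq size_bpow /=; lia.
have Hs t : size (t ++ lb :: winv t ++ [:: linv lb]) = (2 * size t + 2)%N.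
  by rewrite size_cat /= size_cat size_winv /=; lia.
rewrite Hs Ht; nia.
Qed.

Lemma reduced_descent rs : reduced (linv la :: descent rs) /\
  last (linv la) (descent rs) = linv la.
Proof.
elim: rs => [//|r rs [IH1 IH2]]; rewrite /= last_cat /=; split=> //.
rewrite cat_path /= -[path _ _ (descent rs)]/(reduced (linv la :: descent rs)) IH1 andbT.
have H i x : x != lb -> path (fun x y => y != linv x) x (nseq i (linv lb)) &&
    (linv la != linv (last x (nseq i (linv lb)))) = (i == 0%N) ==> (x != la).
  elim: i x => [|i IHi] x xb /=; first by rewrite (inj_eq (inv_inj linvK)) eq_sym.
  by rewrite (inj_eq (inv_inj linvK)) eq_sym xb /= IHi //; case: i {IHi}.
by rewrite H //; apply/implyP.
Qed.

(** As [m] is nonzero, [b^m] keeps [a] and [a^-1] apart. The first and last letters are recorded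
    because the test word glues [b] and [b^-1] to them. *)
Lemma reduced_tower m rs : m != 0 -> reduced (tower m rs) /\
  exists2 t, tower m rs = la :: t & last la t = linv la.
Proof.
move=> m0; have [Hd Hl] := reduced_descent rs.
have [k [x [Em xla xla']]] : exists k x, [/\ bpow m = nseq k.+1 x, x.1 & x != linv x].
  by case: m m0 => [[//|k]|k] _; [exists k, lb|exists k, (linv lb)].
have nseq_path i y : y != linv y -> path (fun x y => y != linv x) y (nseq i y).
  by move=> yy; elim: i => //= i ->; rewrite yy.
have last_nseq i (y : letter) : last y (nseq i y) = y by elim: i.
split; last first.
  exists (nseq (size rs) la ++ bpow m ++ linv la :: descent rs) => //.
  by rewrite !last_cat.
rewrite /tower Em -[nseq _ la]/(la :: nseq _ la) -[nseq _ x]/(x :: nseq _ x).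
apply: reduced_cat; first exact: nseq_path.
  apply: reduced_cat => //; first exact: nseq_path.
  by rewrite last_nseq; case: (x) xla => [[] []].
by rewrite last_nseq; case: (x) xla => [[] []].
Qed.

Lemma reduced_test_word m rs : m != 0 -> reduced (test_word m rs).
Proof.
move=> m0; have [Ht [t Et tl]] := reduced_tower m rs m0.
have Hv := reduced_winv _ Ht.
rewrite /test_word; move: Ht Hv; rewrite Et => Ht Hv.
have Hr : reduced (winv (la :: t) ++ [:: linv lb]).
  have : last lb (winv (la :: t)) = linv la.
    by rewrite /winv map_cons rev_cons last_rcons.
  case: (winv (la :: t)) Hv => [//|y v] Hv /= yl.
  by apply: reduced_cat => //; rewrite yl.
apply: reduced_cat => //; last by rewrite tl.
move: Hr; rewrite lastI tl /winv map_rcons rev_rcons /=.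
by rewrite /reduced /= => ->.
Qed.

(** The arithmetic of [descent]: each residue makes [b^(K - r) a^-1] complete a pinch with an [a]
    before it, leaving a new power of [b]. *)
Fixpoint descends (m n K : int) (rs : seq nat) : bool :=
  if rs is r :: rs' then (m %| K - r%:Z)%Z && descends m n (n * ((K - r%:Z) %/ m)%Z) rs'
  else true.

Lemma descends_exists m n K h : m != 0 ->
  exists rs, [/\ size rs = h, all (fun r => r < `|m|)%N rs & descends m n K rs].
Proof.
move=> m0; elim: h K => [|h IH] K; first by exists [::].
have [rs [Hs Ha Hg]] := IH (n * ((K - `|(K %% m)%Z|%N%:Z) %/ m)%Z).
have Er : `|(K %% m)%Z|%N%:Z = (K %% m)%Z by rewrite gez0_abs ?modz_ge0.
exists (`|(K %% m)%Z|%N :: rs); split => //=; first by rewrite Hs.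
- by rewrite Ha andbT; have := ltz_mod K m0; have := modz_ge0 K m0; lia.
- by rewrite Hg andbT Er -eqz_mod_dvd modz_mod.
Qed.

(** Each division by [m] costs one factor [m], so agreement modulo [m^(size rs)] preserves all
    residues. This carries them to the late terms of any admissible sequence. *)
Lemma descends_mod m n n' K K' rs : m != 0 ->
  (m ^+ size rs %| n - n')%Z -> (m ^+ size rs %| K - K')%Z ->
  descends m n K rs -> descends m n' K' rs.
Proof.
move=> m0; elim: rs K K' => [//|r rs IH] K K' nn KK /= /andP[mK].
have mKK : (m %| K - K')%Z by apply: dvdz_trans KK; rewrite exprS dvdz_mulr.
have mK' : (m %| K' - r%:Z)%Z.
  have -> : K' - r%:Z = K - r%:Z - (K - K') by ring.
  by rewrite rpredB.
have snn : (m ^+ size rs %| n - n')%Z.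
  by apply: dvdz_trans nn; rewrite exprS dvdz_mull.
rewrite mK' /=; apply: IH => //.
move: mK mK'; move=> /dvdzP[j Ej] /dvdzP[j' Ej']; rewrite Ej Ej' !mulzK //.
have -> : n * j - n' * j' = (n - n') * j + n' * (j - j') by ring.
apply: rpredD; first exact: dvdz_mulr.
apply: dvdz_mull; rewrite -(@dvdz_mul2l m) // -exprS.
suff -> : m * (j - j') = K - K' by [].
have -> : K - K' = (K - r%:Z) - (K' - r%:Z) by ring.
by rewrite Ej Ej'; ring.
Qed.

(** With [n - n' = dl d], the induction keeps [(K - K') mh^i = dl d V] with [V] prime to [mh]. A
    common residue gives [K - K' = m (x - x')], hence [(x - x') mh^(i+1) = dl V], and Gauss's lemma
    yields that [mh^(i+1)] divides [dl]. *)
Lemma descends_inj m mh n n' d nu' rs :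
  m != 0 -> m = mh * d -> n' = d * nu' -> coprimez mh nu' -> (d %| n - n')%Z ->
  descends m n n rs -> descends m n' n' rs -> (mh ^+ size rs * d %| n - n')%Z.
Proof.
move=> m0 Em En' cop /dvdzP[dl Edl].
have d0 : d != 0 by apply: contraNneq m0 => d0; rewrite Em d0 mulr0.
suff H i V K K' : coprimez mh V -> (K - K') * mh ^+ i = dl * d * V ->
    (mh ^+ i %| dl)%Z -> descends m n K rs -> descends m n' K' rs ->
    (mh ^+ (i + size rs) %| dl)%Z.
  move=> g g'; rewrite Edl dvdz_mul2r //.
  apply: (H 0%N 1 n n') => //; first by rewrite /coprimez gcdz1.
  by rewrite expr0 !mulr1.
elim: rs i V K K' => [|r rs IH] i V K K' cV KV il; first by rewrite addn0.
move=> /= /andP[/dvdzP[x Ex] g] /andP[/dvdzP[x' Ex'] g'].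
have KK : K - K' = m * (x - x').
  have -> : K - K' = (K - r%:Z) - (K' - r%:Z) by ring.
  by rewrite Ex Ex'; ring.
move: g g'; rewrite Ex Ex' !mulzK // => g g'.
have E1 : (x - x') * mh ^+ i.+1 = dl * V.
  apply: (mulfI d0); transitivity ((K - K') * mh ^+ i); last by rewrite KV; ring.
  by rewrite KK Em exprS; ring.
rewrite /= addnS -addSn; apply: IH g g'.
(* The new [V] comes from [n x - n' x' = (n - n') x + n' (x - x')]; modulo [mh] it is [nu' V], a
   product of units. *)
- instantiate (1 := x * mh ^+ i.+1 + nu' * V).
  rewrite coprimez_sym /coprimez exprSr mulrA addrC gcdzC addrC gcdzMDl.
  by rewrite -[_ == _]/(coprimez _ _) coprimezMr cop.
- have -> : (n * x - n' * x') * mh ^+ i.+1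
      = (n - n') * x * mh ^+ i.+1 + n' * ((x - x') * mh ^+ i.+1) by ring.
  by rewrite E1 Edl En'; ring.
- rewrite -(@Gauss_dvdzl _ dl V) -?E1 ?dvdz_mull //.
  by apply: coprimezXl.
Qed.

Section TestWord.
Variables m n : int.
Hypotheses (m0 : m != 0) (n0 : n != 0).

Lemma run_nseq_a i st : (if st is (_, e) :: _ then ~~ e else true) ->
  run m n (nseq i la) (st, 0) = (nseq i (0, false) ++ st, 0).
Proof.
elim: i st => [//|i IH] st Hst.
have np : ~~ pinch m n false (st, 0 + n * 0).
  by rewrite /pinch /=; case: st Hst => [//|[t []] st].
have H0 : cmod 0 n = 0 by apply: cmod_small; lia.
have -> : run m n (nseq i.+1 la) (st, 0) =
    run m n (nseq i la) (astep m n false (st, 0 + n * 0)).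
  by rewrite mulr0 addr0.
rewrite (astep_push m n m0 n0 false) // mulr0 IH //.
by congr pair; rewrite -cat_rcons -cats1 -[[:: _]]/(nseq 1 _) -nseqD addn1.
Qed.

Lemma run_nseq_bV i s : run m n (nseq i (linv lb)) s = shift (- i%:Z) s.
Proof. by rewrite -(run_bpow m n); congr run; case: i. Qed.

Lemma run_descent_descends K rs st : descends m n K rs ->
  exists k, run m n (descent rs) (nseq (size rs) (0, false) ++ st, K) = (st, k).
Proof.
elim: rs K => [|r rs IH] K /=; first by exists K.
case/andP=> /dvdzP[j Ej]; rewrite Ej mulzK // => /IH[k Hk]; exists k.
rewrite run_cat run_nseq_bV /shift /= Ej mulrC /step /=.
by rewrite (astep_pop m n m0 n0 true) add0r.
Qed.

(** A descent contains only [b^-1] and [a^-1], and [a^-1] never pinches with an [a^-1] on top, so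
    nothing below is popped. *)
Lemma run_descent_push rs st c k : exists st' k',
  run m n (descent rs) ((c, true) :: st, k) = (st' ++ st, k').
Proof.
elim: rs st c k => [|r rs IH] st c k; first by exists [:: (c, true)], k.
rewrite /= run_cat run_nseq_bV /shift /= /step /= /astep /pinch /=.
have [st' [k' ->]] := IH ((c, true) :: st)
  (cmod (k - r%:Z) m) (n * (((k - r%:Z) - cmod (k - r%:Z) m) %/ m)%Z).
by exists (rcons st' (c, true)), k'; rewrite cat_rcons.
Qed.

(** A failing descent pops at most [size rs - 1] entries before its first push, and none afterwards;
    the stack is just high enough for its bottom to survive. *)
Lemma run_descent_stuck K rs t : ~~ descends m n K rs -> exists st k,
  run m n (descent rs) (nseq (size rs).-1 (0, false) ++ [:: (t, false)], K)
    = (rcons st (t, false), k).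
Proof.
elim: rs K => [//|r rs IH] K.
rewrite [descends _ _ _ _]/= negb_and; case: (boolP (m %| K - r%:Z)%Z) => [|np _].
  move=> /dvdzP[j Ej] /=; rewrite Ej mulzK // => stuck.
  rewrite run_cat run_nseq_bV /shift /= Ej mulrC /step /=.
  case: rs IH stuck => [//|r' rs] IH /IH[st [k Hk]]; exists st, k; rewrite -Hk.
  by rewrite [nseq _ _ ++ _]/= (astep_pop m n m0 n0 true) add0r.
rewrite /= run_cat run_nseq_bV /shift /= /step /= /astep.
rewrite /pinch (negbTE np) andbF /=.
set st0 := nseq _ _ ++ _.
have [st' [k' ->]] := run_descent_push rs st0
  (cmod (K - r%:Z) m) (n * (((K - r%:Z) - cmod (K - r%:Z) m) %/ m)%Z).
by exists (st' ++ nseq (size rs) (0, false)), k'; rewrite -cats1 -catA.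
Qed.

Lemma run_tower_tail rs st :
  run m n (bpow m ++ linv la :: descent rs) ((0, false) :: st, 0)
    = run m n (descent rs) (st, n).
Proof.
rewrite run_cat run_bpow /shift /= add0r /step /=.
by have := astep_pop m n m0 n0 true 0 st 1; rewrite !mulr1 add0r => ->.
Qed.

Lemma test_word_trivial rs : descends m n n rs -> BS m n (test_word m rs).
Proof.
move=> /(run_descent_descends _ _ [::])[k Hk].
have Ht : eqBS m n (bpow k) (tower m rs).
  have := state_word_run m n m0 n0 (tower m rs) ([::], 0).
  rewrite /tower run_cat run_nseq_a // run_tower_tail Hk.
  by rewrite /state_word /=.
apply/eqBS_nil; rewrite /test_word.
rewrite -cat1s -Ht -bpowN -[[:: lb]]/(bpow 1) -[[:: linv lb]]/(bpow (-1)).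
by rewrite -!bpowD (_ : k + (1 + (- k - 1)) = 0); [reflexivity|ring].
Qed.

(* If the descent gets stuck, the bottom (t, false) of the stack survives the whole
   tower, and it records whether a letter b was read first. *)
Lemma test_word_descends rs : (0 < size rs)%N -> (2 < `|n|)%N ->
  BS m n (test_word m rs) -> descends m n n rs.
Proof.
move=> rs0 n2 H; apply/negPn/negP => stuck.
have E : eqBS m n (tower m rs ++ [:: lb]) ([:: lb] ++ tower m rs).
  by rewrite /eqBS winv_cat -catA.
have := eqBS_run m n m0 n0 _ _ ([::], 0) E isT.
have Hrun t : exists st k, run m n (nseq (size rs) la ++ bpow m ++ linv la :: descent rs)
    ([:: (t, false)], 0) = (rcons st (t, false), k).
  have [st [k Hk]] := run_descent_stuck _ _ t stuck; exists st, k.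
  rewrite run_cat run_nseq_a // -Hk.
  (* The factor [b^m a^-1] pops one of the [size rs] zeros, which leaves the height required by
     [run_descent_stuck]. *)
  by case: (rs) rs0 => [//|r rs'] _; rewrite [nseq _ _ ++ _]/= run_tower_tail.
(* Here [|n| > 2] is used: 0 and 1 must both be their own centered residues modulo [n]. *)
have cm t : (t == 0) || (t == 1) -> cmod t n = t.
  by move=> t01; apply: cmod_small; lia.
have a0 t : (t == 0) || (t == 1) -> step m n ([::], t) la = ([:: (t, false)], 0).
  move=> t01; rewrite /step /= -[in LHS](addr0 t) -(mulr0 n).
  by rewrite (astep_push m n m0 n0 false) ?mulr0 //; apply: cm.
have -> : tower m rs = [:: la] ++
    (nseq (size rs) la ++ bpow m ++ linv la :: descent rs) by [].
move: (nseq (size rs) la ++ _) Hrun => y Hrun; rewrite !run_cat.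
have -> : run m n [:: la] ([::], 0) = ([:: (0, false)], 0) by apply: a0.
have -> : run m n [:: la] (run m n [:: lb] ([::], 0)) = ([:: (1, false)], 0).
  exact: (a0 1).
have [st [k ->]] := Hrun 0; have [st' [k' ->]] := Hrun 1.
rewrite /= /step /shift /= => -[/(congr1 (last (0, false)))].
by rewrite !last_rcons.
Qed.

End TestWord.

(** * Passing to the limit *)

Lemma zval_mod m (xi : zadic m) k n : (k <= n)%N ->
  (m ^+ k %| zval xi n - zval xi k)%Z.
Proof.
move=> kn; rewrite -(subnK kn); elim: (n - k)%N => [|i IH]; first by rewrite subrr dvdz0.
rewrite addSn -(subrKA (zval xi (i + k))) rpredD //.
by apply: dvdz_trans (zcompat xi _); apply: dvdz_exp2l; apply: leq_addl.
Qed.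

(** [BSbar] quantifies over admissible sequences, so extracting information from it takes one such
    sequence. *)
Lemma admissible_exists m (xi : zadic m) : m != 0 -> exists s, admissible xi s.
Proof.
(* A multiple of [m^n] does not disturb the residues up to level [n]; the summand [|zval xi n|]
   prevents cancellation, so the absolute value is at least [n] even for [m = 1] or [m = -1]. *)
move=> m0; exists (fun n => zval xi n + m ^+ n * (n + `|zval xi n|)%N%:Z).
split=> [B|k]; [exists B|exists k] => n kn.
  have : (n + `|zval xi n| <= `|(m ^+ n * (n + `|zval xi n|)%N%:Z)%R|)%N.
    by rewrite abszM leq_pmull // absz_gt0 expf_neq0.
  by move: (m ^+ n * _) => x; lia.
rewrite addrAC rpredD ?zval_mod // dvdz_mulr //; exact: dvdz_exp2l.
Qed.

Lemma admissible_eventually m (xi : zadic m) s k b : admissible xi s ->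
  exists N, forall n, (N <= n)%N ->
    (b <= `|s n|)%N /\ (m ^+ k %| s n - zval xi k)%Z.
Proof.
move=> [/(_ b)[N1 H1] /(_ k)[N2 H2]]; exists (maxn N1 N2) => n.
by rewrite geq_max => /andP[/H1 ? /H2 ?].
Qed.

(** Both claims can be read modulo [m]: [d] divides [m] and [xi], hence [n], and the Bezout relation
    for [d], divided by [d], gives coprimality. *)
Lemma zgcd_residue m (xi : zadic m) d h n :
  zgcd xi d -> (1 <= h)%N -> (m ^+ h %| n - zval xi h)%Z ->
  exists2 nu, n = d * nu & coprimez (m %/ d)%Z nu.
Proof.
move=> [d0 dm _ [u Hu] [a [b Hab]]] h1 nxi.
have mn1 : (m %| n - zval xi 1)%Z.
  rewrite -(subrKA (zval xi h)) rpredD //.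
    by apply: dvdz_trans nxi; apply: dvdz_exp.
  by have := zval_mod m xi 1 h h1; rewrite expr1.
have dn0 : d != 0 by rewrite gt_eqF.
have Em := divzK dm; move: (m %/ d)%Z Em => mh Em.
have := Hu 1%N; have := Hab 1%N; move: mn1; rewrite expr1.
move: (zval xi 1) (zval u 1) (zval a 1) (zval b 1) => X U A B.
move=> /dvdzP[x Ex] /dvdzP[z Ez] /dvdzP[y Ey].
have EX : X = d * (U + y * mh).
  by rewrite -[LHS](subrK (d * U)) Ey -Em; ring.
exists (U + y * mh + x * mh).
  by rewrite -(subrK X n) Ex {1}EX -Em; ring.
apply/coprimezP; exists (z + A - x * B, B) => /=.
apply: (mulfI dn0); rewrite mulr1.
transitivity (z * m + (m * A + X * B)).
  by rewrite EX -Em; ring.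
by rewrite -Ez subrK.
Qed.

Lemma zcong_residue m (xi xi' : zadic m) c h : c != 0 -> (c %| m ^+ h)%Z ->
  zcong xi xi' c <-> (c %| zval xi h - zval xi' h)%Z.
Proof.
move=> c0 cm; split=> [[z /(_ h) Hz]|ch].
  rewrite -(subrK (c * zval z h) (_ - _)) rpredD ?dvdz_mulr //.
  exact: dvdz_trans Hz.
have ck k : (c %| zval xi (k + h) - zval xi' (k + h))%Z.
  have H x := dvdz_trans cm (zval_mod m x h (k + h) (leq_addl k h)).
  rewrite (_ : _ - _ = (zval xi (k + h) - zval xi h)
     - (zval xi' (k + h) - zval xi' h) + (zval xi h - zval xi' h)); last by ring.
  by rewrite rpredD // rpredB.
(* The index is shifted by [h] because dividing by [c], a divisor of [m^h], can lose [h] levels of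
   precision. *)
pose z k := ((zval xi (k + h) - zval xi' (k + h)) %/ c)%Z.
have Ez k : z k * c = zval xi (k + h) - zval xi' (k + h) by apply: divzK.
have Hz k : (m ^+ k %| z k.+1 - z k)%Z.
  rewrite -(dvdz_mul2r c0) mulrBl !Ez addSn.
  rewrite (_ : _ - _ - _ = (zval xi (k + h).+1 - zval xi (k + h))
     - (zval xi' (k + h).+1 - zval xi' (k + h))); last by ring.
  by apply: (@dvdz_trans (m ^+ (k + h)));
    [rewrite exprD dvdz_mul|rewrite rpredB ?zcompat].
exists (Zadic Hz) => k /=; rewrite [c * _]mulrC Ez.
rewrite (_ : _ - _ = (zval xi' (k + h) - zval xi' k)
     - (zval xi (k + h) - zval xi k)); last by ring.
by rewrite rpredB // zval_mod // leq_addr.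
Qed.

Lemma absz_lt (b x : int) : (`|b| < `|x|)%N -> b < `|x|.
Proof. lia. Qed.

(** One far term of a sequence for [xi] already makes [w] trivial; [BS_transfer] carries this to all
    late terms of any sequence for [xi']. *)
Lemma BSbar_transfer m h (xi xi' : zadic m) d w :
  m != 0 -> (1 <= h)%N -> zgcd xi' d ->
  ((m %/ d)%Z ^+ h * d %| zval xi h - zval xi' h)%Z ->
  (size w <= 2 * h)%N -> BSbar xi w -> BSbar xi' w.
Proof.
move=> m0 h1 gd' cxi wh Hw s' as'.
have [_ dm _ _ _] := gd'; have Em := divzK dm; set mh := (m %/ d)%Z in cxi Em.
have cm : (mh ^+ h * d %| m ^+ h)%Z.
  by rewrite -Em exprMn; apply: dvdz_mul => //; apply: dvdz_exp.
have [s as_] := admissible_exists m xi m0.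
set b := `|(2 * growth (size w) `|m|)%R|%N.+1.
have [N HN] := admissible_eventually m xi s h b as_.
have [N' HN'] := admissible_eventually m xi' s' h b as'.
have [M HM] := Hw s as_.
exists N' => i /HN'[bs' ms'].
have [bs ms] := HN (maxn N M) (leq_maxl _ _).
have [nu En _] := zgcd_residue m xi' d h (s' i) gd' h1 ms'.
apply: (BS_transfer m (s (maxn N M)) (s' i) h) => //.
(* Divisibility by [m = mh d] is the case [i = 1] of [coupled_dvd], which allows depth up to [h]. *)
- move=> B l k k' kk' lh; rewrite -{1}Em -[mh]expr1.
  apply: (coupled_dvd m _ _ d mh h) kk' _ => //; last by rewrite addn1.
    by rewrite En dvdz_mulr.
  rewrite (_ : _ - _ = (s (maxn N M) - zval xi h) - (s' i - zval xi' h)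
    + (zval xi h - zval xi' h)); last by ring.
  by rewrite rpredD // rpredB // (dvdz_trans cm).
- exact: absz_lt bs.
- exact: absz_lt bs'.
- by apply: HM; apply: leq_maxr.
Qed.

Theorem theorem6p1 (m : int) (h : nat) (xi xi' : zadic m) (d : int) :
  m != 0 -> (1 <= h)%N -> zgcd xi d -> zgcd xi' d ->
  (same_rel_upto (BSbar xi) (BSbar xi')
     (2 * (`|m| + 1) * h + 2 * `|m| + 6)%N ->
   zcong xi xi' (((m %/ d)%Z) ^+ h * d)) /\
  (zcong xi xi' (((m %/ d)%Z) ^+ h * d) ->
   same_rel_upto (BSbar xi) (BSbar xi') (2 * h)%N).
Proof.
move=> m0 h1 gd gd'; have [d_gt0 dm _ _ _] := gd.
have d0 : d != 0 by rewrite gt_eqF.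
have Em := divzK dm; have mh0 : (m %/ d)%Z != 0.
  by apply: contraNneq m0 => E; rewrite -Em E mul0r.
have c0 : (m %/ d)%Z ^+ h * d != 0 by rewrite mulf_neq0 ?expf_neq0.
have cm : ((m %/ d)%Z ^+ h * d %| m ^+ h)%Z.
  by rewrite -[X in (_ %| X ^+ _)%Z]Em exprMn; apply: dvdz_mul => //; apply: dvdz_exp.
have cP := zcong_residue m _ _ _ h c0 cm.
split=> [same|/cP cxi].
- apply/cP.
  have [s as_] := admissible_exists m xi m0.
  (* Here [n] is just an integer congruent to [xi] modulo [m^h] that generates the residues, so the
     size bound is 0. *)
  have [N HN] := admissible_eventually m xi s h 0 as_.
  have [_ ms] := HN N (leqnn N); move: (s N) ms => n ms {N HN s as_}.
  have [rs [Hrs rsm grs]] := descends_exists m n n h m0.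
  have /(same _ (reduced_test_word m rs m0)) : (size (test_word m rs) <=
      2 * (`|m| + 1) * h + 2 * `|m| + 6)%N by rewrite -Hrs size_test_word.
  case=> Htest _; have {Htest} : BSbar xi' (test_word m rs).
    apply: Htest => t at_; have [N HN] := admissible_eventually m xi t h 1 at_.
    exists N => i /HN[t1 mt]; apply: test_word_trivial => //; first by rewrite -absz_gt0.
    have mnt : (m ^+ size rs %| n - t i)%Z.
      rewrite Hrs (_ : _ - _ = (n - zval xi h) - (t i - zval xi h)); last by ring.
      by rewrite rpredB.
    exact: descends_mod grs.
  have [s' as'] := admissible_exists m xi' m0.
  move=> /(_ s' as')[M HM].
  (* The bound 3 provides [2 < |n'|] for [test_word_descends]. *)
  have [N HN] := admissible_eventually m xi' s' h 3 as'.
  have := HM (maxn N M) (leq_maxr _ _); have := HN (maxn N M) (leq_maxl _ _).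
  move: (s' _) => n' [n3 ms'] /test_word_descends g'.
  have {}g' : descends m n' n' rs by
    apply: g' => //; [rewrite -absz_gt0 (leq_trans _ n3)|rewrite Hrs].
  have [nu En _] := zgcd_residue m xi d h n gd h1 ms.
  have [nu' En' cop] := zgcd_residue m xi' d h n' gd' h1 ms'.
  have := descends_inj m _ n n' d nu' rs m0 (esym Em) En' cop _ grs g'.
  rewrite Hrs En {1}En' -mulrBr dvdz_mulr // -En => /(_ isT) H.
  rewrite (_ : _ - _ = (n' - zval xi' h) - (n - zval xi h) + (n - n')); last by ring.
  by rewrite rpredD // rpredB // (dvdz_trans cm).
- move=> w _ wh.
  have cxi' : ((m %/ d)%Z ^+ h * d %| zval xi' h - zval xi h)%Z.
    by rewrite -[_ - _]opprB rpredN.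
  by split; [apply: (BSbar_transfer m h xi xi' d)|apply: (BSbar_transfer m h xi' xi d)].
Qed.
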